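(* Let $\pi=1^p2^r1^q$ with integers $p,q,r\ge1$. Then $$\delta(\pi)=\binom{p+q}{p}\frac{p^pq^q}{(p+q)^{p+q}}\,\delta(1^{p+q}2^r)=\binom{p+q}{p}\frac{p^pq^q}{(p+q)^{p+q}}\,\delta([p+q,r]).$$
   Context: $[k]=\{1,\dots,k\}$ and $[k]^n$ is the set of words of length $n$ over $[k]$; permutations in $S_n$ are regarded as words in $[n]^n$. For a letter $a$ and integer $j\ge1$, $a^j$ is the word $a\cdots a$ ($j$ copies). Two words $u,v$ of the same length are order-isomorphic if for all positions $i,j$: $u_i<u_j\iff v_i<v_j$. For a pattern $\pi$ of length $m$ and a word $\sigma\in[k]^n$, $n\ge m$, $\nu(\pi,\sigma)$ is the number of subsequences of $\sigma$ (choices of positions $i_1<\dots<i_m$) order-isomorphic to $\pi$. Let $\delta(\pi,k,n)=\max\{\nu(\pi,\sigma):\sigma\in[k]^n\}/\binom{n}{m}$. The packing density is $\delta(\pi)=\lim_{n\to\infty}\delta(\pi,n,n)=\lim_{n\to\infty}\lim_{k\to\infty}\delta(\pi,k,n)$ (the limit exists). $[a,b]$ denotes the layered permutation of length $a+b$ with two layers of lengths $a$ and $b$, i.e. $a\,(a-1)\cdots1\,(a+b)\,(a+b-1)\cdots(a+1)$; by abuse of notation $[a,b]$ is also used for the nondecreasing word $1^a2^b$ (the two have the same packing density). *)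

(* Defs.v *)
From mathcomp Require Import all_boot all_order all_algebra.
From mathcomp Require Import all_classical all_reals all_analysis.

Set Implicit Arguments.
Unset Strict Implicit.
Unset Printing Implicit Defensive.

Import Order.TTheory GRing.Theory Num.Theory.
Import numFieldNormedType.Exports.

Local Open Scope ring_scope.

Definition order_iso (u v : seq nat) : bool :=
  (size u == size v) &&
  [forall i : 'I_(size u), forall j : 'I_(size u),
     (nth 0 u i < nth 0 u j)%N == (nth 0 v i < nth 0 v j)%N].

(* A set of positions of s is given by its indicator b, so occurrences with
   equal letters at different positions are counted separately. *)
Definition nu (pi s : seq nat) : nat :=
  #|[set b : (size s).-tuple bool | order_iso pi (mask b s)]|.

(* The ordinal i : 'I_k, with 0 <= i < k, stands for the letter i + 1. *)
Definition letters (k : nat) (s : seq 'I_k) : seq nat :=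
  [seq (nat_of_ord i).+1 | i <- s].

(* For n < size pi both the numerator and the binomial vanish and the quotient
   is 0; these n do not affect the limit below. *)
Definition delta (R : realType) (pi : seq nat) (k n : nat) : R :=
  (\max_(s : n.-tuple 'I_k) nu pi (letters s))%:R / 'C(n, size pi)%:R.

(* The limit exists for nonempty pi: for n >= size pi, averaging over the
   one-letter deletions of a word shows that delta R pi n n is nonincreasing
   in n. *)
Definition packing_density (R : realType) (pi : seq nat) : R :=
  limn (fun n : nat => delta R pi n n).

Definition word12 (a b : nat) : seq nat := nseq a 1%N ++ nseq b 2%N.

Definition word121 (p r q : nat) : seq nat :=
  nseq p 1%N ++ nseq r 2%N ++ nseq q 1%N.

(* a (a-1) ... 1 (a+b) (a+b-1) ... (a+1) *)
Definition layered2 (a b : nat) : seq nat := rev (iota 1 a) ++ rev (iota a.+1 b).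

(* Main.v *)
Require Import Defs.
From mathcomp Require Import all_boot all_order all_algebra.
From mathcomp Require Import all_classical all_reals all_analysis.
From mathcomp Require Import perm.
From mathcomp Require Import zify ring.

(** Let [P = p + q] and [m = P + r], and let [n_x] be the number of occurrences
of the letter [x] in a word of length [n].

In an occurrence of [1^p 2^r 1^q] the copies of the large letter [y] separate
the copies of the small letter [x]: [p] of them are taken among the [u] ones to
the left of the block and [q] among the [v] ones to the right of it, with
[u + v <= n_x].  The number of occurrences with letters [x < y] is therefore at
most [h(n_x) C(n_y, r)], where [h(t)] is the maximum of [C(u,p) C(t-u,q)]
([best_split]).  The bound is attained for all pairs of letters at once by the
nested word [1^(u_1) 2^(u_2) ... n^(v_n) ... 2^(v_2) 1^(v_1)] with [u_x + v_x =
n_x] optimal for [h(n_x)].  Hence the maximal count over words is exactly the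
maximum over all letter counts of [sum_(x<y) h(n_x) C(n_y, r)] ([max_nu121]).
For [q = 0] this is [sum_(x<y) C(n_x, P) C(n_y, r)], the maximum for
[1^P 2^r] ([max_nu12]).

The two maxima are then compared term by term.  The weighted inequality of
arithmetic and geometric means, and the choice [u = floor(p t / P)], show that
[P^P p! q! h(t)] and [p^p q^q P! C(t, P)] both lie between
[p^p q^q (t - P)^P] and [p^p q^q t^P], so that they differ by [O(t^(P-1))].
Summed over pairs of letters this is [O(n^(m-1))], which is negligible against
[C(n, m)].  The ratio of the two normalizing constants is the constant of the
theorem.  The limit for [1^P 2^r] exists because deleting one position at random
shows that the densities are nonincreasing ([max_pair_sum_delete],
[cvg_two_layer_density]); the limit for [1^p 2^r 1^q] follows.

For the permutation with layers of lengths [P] and [r] the maximum is the same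
number for every [n] ([max_nu_layered2]).  An occurrence in a word is a pair [(A, B)] of antichains,
of sizes [P] and [r] and with every element of [A] below every element of [B],
for the strict order in which a position is below another one if it is to the
left and carries a smaller letter.  Zykov symmetrization replaces this order by
a weak order without decreasing the number of such pairs: if [x] and [y] are
incomparable, one of them may be replaced by a copy of the other ([clone]).  In
a weak order the pairs are counted by [sum_(x<y) C(n_x, P) C(n_y, r)], where the
[n_x] are the sizes of the classes.  Conversely the layered permutation with
layers of sizes [n_x] has at least that many occurrences. *)

Set Implicit Arguments.
Unset Strict Implicit.
Unset Printing Implicit Defensive.

Import Order.TTheory GRing.Theory Num.Theory.
Import numFieldNormedType.Exports.

Local Open Scope nat_scope.

(** * Order isomorphism with two-letter patterns *)

Lemma order_isoP (u v : seq nat) :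
  reflect (size u = size v /\
           forall i j, i < size u -> j < size u ->
             (nth 0 u i < nth 0 u j) = (nth 0 v i < nth 0 v j))
          (order_iso u v).
Proof.
apply: (iffP andP) => [[/eqP sz /forallP H]|[sz H]]; split => //.
- move=> i j ltiu ltju.
  by move/forallP: (H (Ordinal ltiu)) => /(_ (Ordinal ltju)) /eqP.
- exact/eqP.
- by apply/forallP => i; apply/forallP => j; rewrite H.
Qed.

Lemma order_iso_map (phi : nat -> nat) (u : seq nat) :
  {in u &, {mono phi : a b / a < b}} -> order_iso u (map phi u).
Proof.
move=> mono_phi; apply/order_isoP; rewrite size_map; split => // i j ltiu ltju.
by rewrite !(nth_map 0) // mono_phi // mem_nth.
Qed.

Lemma order_iso_mono (phi : nat -> nat) (u v : seq nat) :
  {in v &, {mono phi : a b / a < b}} ->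
  order_iso u (map phi v) = order_iso u v.
Proof.
move=> mono_phi; apply/order_isoP/order_isoP; rewrite size_map;
  move=> [sz H]; split => // i j ltiu ltju.
  by rewrite H // !(nth_map 0) -?sz // mono_phi // mem_nth -?sz.
by rewrite H // !(nth_map 0) -?sz // mono_phi // mem_nth -?sz.
Qed.

(** The relabelling sends an entry [a] of [u] to the entry of [v] at the first
position of [a]; it is well defined because equality of two entries is the
absence of a strict inequality in either direction. *)
Lemma order_iso_relabel (u v : seq nat) : order_iso u v ->
  exists2 phi, v = map phi u & {in u &, {mono phi : a b / a < b}}.
Proof.
move=> /order_isoP[sz H]; exists (fun a => nth 0 v (index a u)).
  apply: (@eq_from_nth _ 0); rewrite ?size_map // => i; rewrite -sz => ltiu.
  rewrite (nth_map 0) //; set j := index _ u.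
  have ltju : j < size u by rewrite index_mem mem_nth.
  have uj : nth 0 u j = nth 0 u i by rewrite nth_index // mem_nth.
  have := H i j ltiu ltju; have := H j i ltju ltiu.
  rewrite uj ltnn; lia.
move=> a b au bu /=.
by rewrite -H ?index_mem // !nth_index.
Qed.

Lemma order_iso_word121P (p r q : nat) (w : seq nat) : 0 < p -> 0 < r ->
  reflect (exists x y, x < y /\ w = nseq p x ++ nseq r y ++ nseq q x)
          (order_iso (word121 p r q) w).
Proof.
move=> p_gt0 r_gt0; apply: (iffP idP);
  last move=> [x [y [ltxy ->]]]; first move=> /order_iso_relabel[phi -> mono_phi].
  exists (phi 1), (phi 2); split; last by rewrite /word121 !map_cat !map_nseq.
  by rewrite mono_phi //; rewrite !mem_cat !mem_nseq p_gt0 r_gt0 ?orbT.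
pose phi a := if a == 1 then x else y.
rewrite (_ : nseq p x ++ _ = map phi (word121 p r q)).
  have entry a : a \in word121 p r q -> a = 1 \/ a = 2.
    rewrite !mem_cat !mem_nseq.
    by case/or3P => /andP[_ /eqP ->]; [left|right|left].
  apply: order_iso_map => a b /entry a12 /entry b12.
  by case: a12 => ->; case: b12 => ->; rewrite /phi /=; lia.
by rewrite /word121 !map_cat !map_nseq.
Qed.

Lemma word12E (p r : nat) : word12 p r = word121 p r 0.
Proof. by rewrite /word121 cats0. Qed.

(** * Occurrences as sets of positions *)

(** Sets of positions replace boolean masks: [enum A] lists the positions in
increasing order, and sets can be split, united and counted by binomial
coefficients. *)
Definition occ n (pi : seq nat) (g : 'I_n -> nat) : {set {set 'I_n}} :=
  [set A : {set 'I_n} | order_iso pi [seq g i | i <- enum A]].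

Definition ord_lt n : rel 'I_n := fun i j => i < j.

Lemma ord_lt_trans n : transitive (@ord_lt n).
Proof. by move=> j i k; apply: ltn_trans. Qed.

Lemma sorted_ord_filter n (a : pred 'I_n) :
  sorted (@ord_lt n) [seq i <- enum 'I_n | a i].
Proof.
apply: sorted_filter; first exact: ord_lt_trans.
rewrite -[sorted _ _]/(sorted (relpre val ltn) _) -sorted_map.
by rewrite val_enum_ord iota_ltn_sorted.
Qed.

Lemma sorted_enum n (A : {set 'I_n}) : sorted (@ord_lt n) (enum A).
Proof.
rewrite {1}/enum_mem -enumT; apply: sorted_ord_filter.
Qed.

Lemma enum_unique n (A : {set 'I_n}) (s : seq 'I_n) :
  sorted (@ord_lt n) s -> A =i s -> enum A = s.
Proof.
move=> sorted_s eqAs; apply: (@irr_sorted_eq _ (@ord_lt n)) => //.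
- exact: ord_lt_trans.
- by move=> i; rewrite /ord_lt ltnn.
- exact: sorted_enum.
- by move=> i; rewrite mem_enum eqAs.
Qed.

(** A mask and the set of positions that it selects determine each other. *)
Lemma nuE n (pi s : seq nat) : size s = n ->
  nu pi s = #|occ pi (fun i : 'I_n => nth 0 s i)|.
Proof.
move=> <- {n}; rewrite /nu.
pose F (A : {set 'I_(size s)}) :=
  [tuple of map (fun i => i \in A) (ord_tuple (size s))].
pose G (b : (size s).-tuple bool) := [set i | tnth b i].
have GK : cancel G F.
  move=> b; apply: eq_from_tnth => i.
  by rewrite tnth_map tnth_ord_tuple inE.
have FK : cancel F G.
  move=> A; apply/setP => i; rewrite inE.
  by rewrite tnth_map tnth_ord_tuple.
have maskF A : mask (F A) s = [seq nth 0 s (nat_of_ord i) | i <- enum A].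
  rewrite -[X in mask _ X](@mkseq_nth _ 0) /mkseq -val_enum_ord -map_comp.
  rewrite -map_mask -filter_mask; congr (map _ _).
  apply/esym/enum_unique; last by move=> i; rewrite mem_filter mem_enum andbT.
  exact: sorted_ord_filter.
rewrite -(card_imset _ (can_inj FK)); apply: eq_card => b.
apply/idP/imsetP => [|[A]]; rewrite !inE => H.
  by exists (G b); rewrite ?GK // inE -maskF GK.
by move=> ->; rewrite maskF.
Qed.

(** The shift by one in [letters] is an increasing relabelling and does not
affect order isomorphism. *)
Lemma nu_letters n k (pi : seq nat) (s : n.-tuple 'I_k) :
  nu pi (letters s) = #|occ pi (fun i => tnth s i)|.
Proof.
rewrite (@nuE n) ?size_map ?size_tuple //; apply: eq_card => A; rewrite !inE.
rewrite -[RHS](@order_iso_mono S) -?map_comp; last by move=> a b _ _; rewrite ltnS.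
congr order_iso; apply: eq_map => i /=.
by rewrite (tnth_nth (tnth s i)) (nth_map (tnth s i)) ?size_tuple.
Qed.

Lemma enum_setU_lt n (A B : {set 'I_n}) :
  (forall a b, a \in A -> b \in B -> a < b) ->
  enum (A :|: B) = enum A ++ enum B.
Proof.
move=> ltAB; apply: enum_unique; last first.
  by move=> i; rewrite inE mem_cat !mem_enum.
rewrite (sorted_pairwise (@ord_lt_trans n)) pairwise_cat
  -!(sorted_pairwise (@ord_lt_trans n)) !sorted_enum !andbT.
by apply/allrelP => i j; rewrite !mem_enum; apply: ltAB.
Qed.

(** Cutting the increasing list of positions cuts the set of positions into an
initial and a final part. *)
Lemma enum_split n (A : {set 'I_n}) (u v : seq 'I_n) : enum A = u ++ v ->
  exists A1 A2 : {set 'I_n}, [/\ A = A1 :|: A2, enum A1 = u, enum A2 = v &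
    forall a b, a \in A1 -> b \in A2 -> a < b].
Proof.
move=> eA; exists [set i in u], [set i in v].
have := sorted_enum A; rewrite eA.
rewrite (sorted_pairwise (@ord_lt_trans n)) pairwise_cat
  -!(sorted_pairwise (@ord_lt_trans n)) =>
  /and3P[/allrelP ltuv su sv].
split.
- by apply/setP => i; rewrite !inE -mem_cat -eA mem_enum.
- by apply: enum_unique => // i; rewrite inE.
- by apply: enum_unique => // i; rewrite inE.
- by move=> a b; rewrite !inE; apply: ltuv.
Qed.

(** * Extremal counts of the pattern 1...1 2...2 1...1 *)

Definition fiber n k (f : 'I_n -> 'I_k) (x : 'I_k) : {set 'I_n} :=
  [set i | f i == x].

(** The maximal counts of all three patterns are maxima of such sums; in them
only the numbers of occurrences of the letters matter. *)
Definition pair_sum n (a b : nat -> nat) (f : 'I_n -> 'I_n) : nat :=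
  \sum_(x < n) \sum_(y < n | x < y) a #|fiber f x| * b #|fiber f y|.

(** The largest number of ways to choose [p] copies of a letter from a left part
and [q] copies from a right part, over all ways to cut [t] copies in two. *)
Definition best_split (p q t : nat) : nat :=
  \max_(u < t.+1) 'C(u, p) * 'C(t - u, q).

Lemma best_splitP (p q t : nat) :
  exists2 u, u <= t & best_split p q t = 'C(u, p) * 'C(t - u, q).
Proof.
have [|u eu] := @bigop.eq_bigmax _ (fun u : 'I_t.+1 => 'C(u, p) * 'C(t - u, q)).
  by rewrite card_ord.
by exists u; rewrite // -ltnS.
Qed.

Lemma best_split_max (p q t u v : nat) : u + v <= t ->
  'C(u, p) * 'C(v, q) <= best_split p q t.
Proof.
move=> le_uvt; have ltut : u < t.+1 by lia.
apply: leq_trans (leq_bigmax (Ordinal ltut)) => /=.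
by rewrite leq_mul2l leq_bin2l ?orbT //; lia.
Qed.

Lemma best_split0 (p t : nat) : best_split p 0 t = 'C(t, p).
Proof.
apply/eqP; rewrite eqn_leq; apply/andP; split.
  apply/bigmax_leqP => u _; rewrite bin0 muln1 leq_bin2l //.
  by rewrite -ltnS ltn_ord.
by rewrite -[X in X <= _]muln1 -(bin0 0) best_split_max ?addn0.
Qed.

Lemma card_disjoint_cover (I T : finType) (P : pred I) (S : {set T})
    (O : I -> {set T}) :
  (forall i A, P i -> A \in O i -> A \in S) ->
  (forall A, A \in S -> exists2 i, P i & A \in O i) ->
  (forall i j A, P i -> P j -> A \in O i -> A \in O j -> i = j) ->
  #|S| = \sum_(i | P i) #|O i|.
Proof.
move=> subS covS uniqO.
under eq_bigr do rewrite -sum1_card big_mkcond.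
rewrite exchange_big -sum1_card big_mkcond; apply: eq_bigr => A _ /=.
have [/covS[i Pi Ai]|notS] := boolP (A \in S).
  rewrite (bigD1 i) //= Ai big1 ?addn0 // => j /andP[Pj neji].
  by case: ifP => // Aj; rewrite (uniqO j i A) ?eqxx in neji.
by rewrite big1 // => i Pi; case: ifP => // /(subS _ _ Pi); rewrite (negbTE notS).
Qed.

Definition occ_at n (g : 'I_n -> 'I_n) (p r q x y : nat) : {set {set 'I_n}} :=
  [set A : {set 'I_n} | [seq nat_of_ord (g i) | i <- enum A]
     == nseq p x ++ nseq r y ++ nseq q x].

Lemma card_occ_word121 n (p r q : nat) (g : 'I_n -> 'I_n) : 0 < p -> 0 < r ->
  #|occ (word121 p r q) g| =
  \sum_(x < n) \sum_(y < n | x < y) #|occ_at g p r q x y|.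
Proof.
move=> p_gt0 r_gt0.
rewrite (pair_big_dep predT (fun x y : 'I_n => x < y)) /=.
apply: card_disjoint_cover => [[x y] A ltxy|A|[x y] [x' y'] A _ _].
- rewrite !inE => /eqP eA.
  by apply/order_iso_word121P => //; exists x, y.
- rewrite inE => /order_iso_word121P[//|//|x [y [ltxy eA]]].
  have mem_g z : z \in [seq nat_of_ord (g i) | i <- enum A] ->
      exists z' : 'I_n, z = z'.
    by case/mapP => i _ ->; exists (g i).
  have [x' ex] : exists x' : 'I_n, x = x'.
    by apply: mem_g; rewrite eA !mem_cat !mem_nseq p_gt0 eqxx.
  have [y' ey] : exists y' : 'I_n, y = y'.
    by apply: mem_g; rewrite eA !mem_cat !mem_nseq r_gt0 eqxx orbT.
  by subst x y; exists (x', y') => //; rewrite inE eA.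
- rewrite !inE => /eqP -> /eqP /= eq_w.
  (* the letters x and y sit at positions 0 and p of the word *)
  have := congr1 (nth 0 ^~ 0) eq_w; have := congr1 (nth 0 ^~ p) eq_w.
  rewrite !nth_cat !size_nseq ltnn p_gt0 subnn r_gt0 !nth_nseq r_gt0 p_gt0.
  by move=> /val_inj -> /val_inj ->.
Qed.

Lemma map_enum_const n (g : 'I_n -> nat) (A : {set 'I_n}) (x : nat) :
  (forall i, i \in A -> g i = x) -> [seq g i | i <- enum A] = nseq #|A| x.
Proof.
move=> gA; rewrite cardE -(size_map g); apply/all_pred1P/allP => _ /mapP[i iA ->] /=.
by rewrite gA // -mem_enum.
Qed.

Lemma map_enum_nseq n (g : 'I_n -> nat) (A : {set 'I_n}) (m x : nat) :
  [seq g i | i <- enum A] = nseq m x -> #|A| = m /\ forall i, i \in A -> g i = x.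
Proof.
move=> eA; split; first by rewrite cardE -(size_map g) eA size_nseq.
move=> i; rewrite -mem_enum => /(map_f g); rewrite eA mem_nseq.
by case/andP => _ /eqP.
Qed.

Definition draws n (X : {set 'I_n}) (k : nat) : {set {set 'I_n}} :=
  [set A : {set 'I_n} | A \subset X & #|A| == k].

Lemma card_bigcup_le (I T : finType) (P : pred I) (F : I -> {set T}) :
  #|\bigcup_(i | P i) F i| <= \sum_(i | P i) #|F i|.
Proof.
elim/big_rec2: _ => [|i m X _ leXm]; first by rewrite cards0.
by apply: leq_trans (leq_card_setU _ _) _; rewrite leq_add2l.
Qed.

(** Once the set [B] of positions of the large letter is fixed, the [p] first
positions lie among those to the left of all of [B] and the [q] last ones among
those to the right.  These two parts of the fiber of [x] are disjoint, as [B] is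
nonempty, so at most [best_split] choices remain. *)
Lemma card_occ_at_le n (g : 'I_n -> 'I_n) (p r q : nat) (x y : 'I_n) : 0 < r ->
  #|occ_at g p r q x y| <= best_split p q #|fiber g x| * 'C(#|fiber g y|, r).
Proof.
move=> r_gt0.
pose L (B : {set 'I_n}) := [set i in fiber g x | [forall b in B, i < b]].
pose M (B : {set 'I_n}) := [set i in fiber g x | [forall b in B, b < i]].
pose U (B : {set 'I_n}) :=
  [set A :|: (B :|: C) | A in draws (L B) p, C in draws (M B) q].
have sub : occ_at g p r q x y \subset \bigcup_(B in draws (fiber g y) r) U B.
  apply/fintype.subsetP => S; rewrite inE => /eqP eS.
  have := esym (cat_take_drop p (enum S)) => /enum_split[A [BC [eqS eA eBC ltABC]]].
  have := esym (cat_take_drop r (enum BC)) => /enum_split[B [C [eqBC eB eC ltBC]]].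
  subst BC.
  have /map_enum_nseq[cA gA] :
      [seq nat_of_ord (g i) | i <- enum A] = nseq p (nat_of_ord x).
    by rewrite eA map_take eS take_cat size_nseq ltnn subnn take0 cats0.
  have eDS : [seq nat_of_ord (g i) | i <- drop p (enum S)] =
      nseq r (nat_of_ord y) ++ nseq q (nat_of_ord x).
    by rewrite map_drop eS drop_cat size_nseq ltnn subnn drop0.
  have /map_enum_nseq[cB gB] :
      [seq nat_of_ord (g i) | i <- enum B] = nseq r (nat_of_ord y).
    by rewrite eB eBC map_take eDS take_cat size_nseq ltnn subnn take0 cats0.
  have /map_enum_nseq[cC gC] :
      [seq nat_of_ord (g i) | i <- enum C] = nseq q (nat_of_ord x).
    by rewrite eC eBC map_drop eDS drop_cat size_nseq ltnn subnn drop0.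
  apply/bigcupP; exists B.
    rewrite inE cB eqxx andbT; apply/fintype.subsetP => i /gB gi.
    by rewrite inE -val_eqE /= gi.
  apply/imset2P; exists A C; rewrite ?eqS //; rewrite inE ?cA ?cC eqxx andbT.
    apply/fintype.subsetP => i iA; rewrite !inE -val_eqE /= gA // eqxx /=.
    by apply/forall_inP => b bB; apply: ltABC; rewrite // inE bB.
  apply/fintype.subsetP => i iC; rewrite !inE -val_eqE /= gC // eqxx /=.
  by apply/forall_inP => b bB; apply: ltBC.
apply: leq_trans (subset_leq_card sub) _.
apply: leq_trans (card_bigcup_le _ _) _.
rewrite mulnC -cards_draws -sum_nat_const; apply: leq_sum => B.
rewrite inE => /andP[_ /eqP cB].
rewrite /U curry_imset2X; apply: leq_trans (leq_imset_card _ _) _.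
rewrite cardsX !cards_draws best_split_max //.
have [b bB] : exists b, b \in B by apply/set0Pn; rewrite -cards_eq0 cB -lt0n.
rewrite -cardsUI (_ : L B :&: M B = finset.set0) ?cards0 ?addn0.
  by apply: subset_leq_card; apply/fintype.subsetP => i; rewrite !inE => /orP[]/andP[].
apply/setP => i; rewrite !inE; apply/negP.
move=> /andP[/andP[_ /forall_inP H1] /andP[_ /forall_inP H2]].
by have := H1 _ bB; have := H2 _ bB; lia.
Qed.

Lemma card_occ_word121_le n (p r q : nat) (g : 'I_n -> 'I_n) : 0 < p -> 0 < r ->
  #|occ (word121 p r q) g| <= pair_sum (best_split p q) (fun t => 'C(t, r)) g.
Proof.
move=> p_gt0 r_gt0; rewrite card_occ_word121 //.
by apply: leq_sum => x _; apply: leq_sum => y _; apply: card_occ_at_le.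
Qed.

(** This turns the construction of a word with a prescribed arrangement of its
letters into the choice of a sorting key. *)
Lemma sort_by_key n (key : 'I_n -> nat) :
  exists s : {perm 'I_n}, forall i j : 'I_n, i <= j -> key (s i) <= key (s j).
Proof.
pose t := sort (relpre key leq) (enum 'I_n).
have sz : size t == n by rewrite size_sort size_enum_ord.
have inj_t : injective (tnth (Tuple sz)).
  by apply/tuple_uniqP; rewrite /= sort_uniq enum_uniq.
exists (perm inj_t) => i j leij; rewrite !permE !(tnth_nth i) /=.
have sorted_t : sorted (relpre key leq) t.
  by apply: sort_sorted => a b; apply: leq_total.
apply: (sorted_leq_nth _ _ _ sorted_t) => //.
- by move=> a b c; apply: leq_trans.
- by move=> a /=.
- by rewrite inE (eqP sz).
- by rewrite inE (eqP sz).
Qed.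

(** When all copies of [y] lie between [L] and [R], the choices inside [L], [R]
and the fiber of [y] are independent, and each gives an occurrence. *)
Lemma card_occ_at_ge n (g : 'I_n -> 'I_n) (p r q : nat) (x y : 'I_n)
    (L R : {set 'I_n}) :
  x != y -> L \subset fiber g x -> R \subset fiber g x ->
  (forall i j, i \in L -> j \in R -> i < j) ->
  (forall i j, i \in L -> j \in fiber g y -> i < j) ->
  (forall i j, i \in fiber g y -> j \in R -> i < j) ->
  'C(#|L|, p) * 'C(#|R|, q) * 'C(#|fiber g y|, r) <= #|occ_at g p r q x y|.
Proof.
move=> nexy /fintype.subsetP subL /fintype.subsetP subR ltLR ltLY ltYR.
pose D := finset.setX (draws L p) (finset.setX (draws (fiber g y) r) (draws R q)).
pose F (t : {set 'I_n} * ({set 'I_n} * {set 'I_n})) := t.1 :|: (t.2.1 :|: t.2.2).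
pose G (S : {set 'I_n}) := (S :&: L, (S :&: fiber g y, S :&: R)).
have notY i : i \in fiber g x -> i \in fiber g y -> false.
  by rewrite !inE => /eqP -> /eqP exy; rewrite exy eqxx in nexy.
have notLR i : i \in L -> i \in R -> false.
  by move=> iL iR; have := ltLR _ _ iL iR; rewrite ltnn.
have FK : {in D, cancel F G}.
  move=> [A [B C]]; rewrite !finset.in_setX /= => /and3P[].
  rewrite 3!inE => /andP[/fintype.subsetP sA _] /andP[/fintype.subsetP sB _].
  move=> /andP[/fintype.subsetP sC _].
  rewrite /G /F /=.
  have excl i : [&& (i \in A) ==> (i \in L), (i \in B) ==> (i \in fiber g y),
      (i \in C) ==> (i \in R), ~~ ((i \in L) && (i \in fiber g y)),
      ~~ ((i \in fiber g y) && (i \in R)) & ~~ ((i \in L) && (i \in R))].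
    apply/and4P; split;
      [exact/implyP/sA | exact/implyP/sB | exact/implyP/sC | ].
    apply/and3P; split; apply/andP.
    - by case=> /subL/notY H /H.
    - by case=> iY /subR/notY/(_ iY).
    - by case=> /notLR H /H.
  congr (_, (_, _)); apply/setP => i; move: (excl i);
    rewrite !(finset.in_setI, finset.in_setU);
    by do 6!case: (i \in _).
have cardD : #|D| = 'C(#|L|, p) * 'C(#|R|, q) * 'C(#|fiber g y|, r).
  by rewrite !cardsX !cards_draws; lia.
rewrite -cardD -(card_in_imset (can_in_inj FK)); apply: subset_leq_card.
apply/fintype.subsetP => _ /imsetP[[A [B C]] + ->].
rewrite !finset.in_setX /= => /and3P[].
rewrite 3!inE => /andP[/fintype.subsetP sA /eqP cA].
move=> /andP[/fintype.subsetP sB /eqP cB] /andP[/fintype.subsetP sC /eqP cC].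
rewrite /F inE /= enum_setU_lt; last first.
  move=> i j /sA iL; rewrite inE => /orP[/sB jY|/sC jR]; first exact: ltLY.
  exact: ltLR.
rewrite enum_setU_lt; last by move=> i j /sB iY /sC jR; apply: ltYR.
rewrite !map_cat; apply/eqP; congr (_ ++ (_ ++ _)).
- by rewrite -cA; apply: map_enum_const => i /sA /subL; rewrite inE => /eqP ->.
- by rewrite -cB; apply: map_enum_const => i /sB; rewrite inE => /eqP ->.
- by rewrite -cC; apply: map_enum_const => i /sC /subR; rewrite inE => /eqP ->.
Qed.

(** The word is [1^(u_1) 2^(u_2) ... n^(v_n) ... 1^(v_1)]: larger letters are
nested inside smaller ones, so the optimal splits of all letters are realized
simultaneously. *)
Lemma occ_word121_ge n (p r q : nat) (f : 'I_n -> 'I_n) : 0 < p -> 0 < r ->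
  exists g : 'I_n -> 'I_n,
    pair_sum (best_split p q) (fun t => 'C(t, r)) f <= #|occ (word121 p r q) g|.
Proof.
move=> p_gt0 r_gt0.
have /boolp.choice[u uP] : forall t, exists u,
    u <= t /\ best_split p q t = 'C(u, p) * 'C(t - u, q).
  by move=> t; have [u] := best_splitP p q t; exists u.
pose L x := [set i in take (u #|fiber f x|) (enum (fiber f x))].
have subL x : L x \subset fiber f x.
  by apply/fintype.subsetP => i; rewrite inE => /mem_take; rewrite mem_enum.
have cardL x : #|L x| = u #|fiber f x|.
  rewrite cardsE (card_uniqP _) ?take_uniq ?enum_uniq // size_takel //.
  by rewrite -cardE; have [] := uP #|fiber f x|.
(* Left copies come first, by increasing letter; right copies follow, by
   decreasing letter, since their keys exceed [n]. *)
pose key i := if i \in L (f i) then nat_of_ord (f i) else n + n - f i.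
have [s key_le] := sort_by_key key.
have key_lt i j : key (s i) < key (s j) -> i < j.
  by apply: contraTT; rewrite -!leqNgt; apply: key_le.
exists (f \o s); rewrite card_occ_word121 //.
apply: leq_sum => x _; apply: leq_sum => y ltxy.
have fiberE z : fiber (f \o s) z = s @^-1: fiber f z by apply/setP => i; rewrite !inE.
have -> : #|fiber f y| = #|fiber (f \o s) y|.
  by rewrite fiberE card_preimset //; apply: perm_inj.
have [_ ->] := uP #|fiber f x|.
have -> : u #|fiber f x| = #|s @^-1: L x|.
  by rewrite card_preimset ?cardL //; apply: perm_inj.
have -> : #|fiber f x| - #|s @^-1: L x| = #|s @^-1: (fiber f x :\: L x)|.
  rewrite !card_preimset; try exact: perm_inj.
  by rewrite cardsD (finset.setIidPr (subL x)).
have keyL i : i \in s @^-1: L x -> key (s i) = x.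
  rewrite inE => iL; have := fintype.subsetP (subL x) _ iL; rewrite inE => /eqP fx.
  by rewrite /key fx iL.
have keyY i : i \in fiber (f \o s) y -> x < key (s i) < n + n - x.
  rewrite inE => /eqP /= fy; rewrite /key fy; have := ltn_ord y.
  by case: ifP => _; lia.
have keyR i : i \in s @^-1: (fiber f x :\: L x) -> key (s i) = n + n - x.
  by rewrite !inE => /andP[+ /eqP fx]; rewrite -fx /key inE => /negbTE ->.
apply: card_occ_at_ge.
- by rewrite neq_ltn ltxy.
- by rewrite fiberE; apply: preimsetS.
- by rewrite fiberE; apply: preimsetS; apply: subsetDl.
- move=> i j /keyL ki /keyR kj; apply: key_lt.
  by rewrite ki kj; have := ltn_ord x; lia.
- move=> i j /keyL ki /keyY kj; apply: key_lt.
  by rewrite ki; case/andP: kj.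
- move=> i j /keyY ki /keyR kj; apply: key_lt.
  by rewrite kj; case/andP: ki.
Qed.

Definition max_pair_sum n (a b : nat -> nat) : nat :=
  \max_(f : {ffun 'I_n -> 'I_n}) pair_sum a b f.

Lemma max_pair_sum_ge n (a b : nat -> nat) (f : 'I_n -> 'I_n) :
  pair_sum a b f <= max_pair_sum n a b.
Proof.
apply: leq_trans (leq_bigmax (finfun f)).
by rewrite /pair_sum (_ : finfun f = f :> (_ -> _)) //; apply/boolp.funext/ffunE.
Qed.

Lemma max_nu121 n (p r q : nat) : 0 < p -> 0 < r ->
  \max_(s : n.-tuple 'I_n) nu (word121 p r q) (letters s) =
  max_pair_sum n (best_split p q) (fun t => 'C(t, r)).
Proof.
move=> p_gt0 r_gt0; apply/eqP; rewrite eqn_leq; apply/andP; split.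
  apply/bigmax_leqP => s _; rewrite nu_letters.
  exact: leq_trans (card_occ_word121_le _ _ p_gt0 r_gt0) (max_pair_sum_ge _ _ _).
apply/bigmax_leqP => f _.
have [g le_g] := occ_word121_ge q f p_gt0 r_gt0.
apply: leq_trans le_g _; apply: leq_trans (leq_bigmax [tuple g i | i < n]).
rewrite nu_letters; apply/eq_leq/eq_card => A; rewrite !inE.
by congr order_iso; apply: eq_map => i; rewrite tnth_mktuple.
Qed.

(** * Pairs of layers in a strict order *)

(** A layer of a permutation is a decreasing run, so two of its elements are
incomparable when positions and letters are both compared; hence antichains. *)
Definition layered (T : finType) (D : rel T) (A B : {set T}) : bool :=
  [&& [forall i in A, forall j in A, ~~ D i j],
      [forall i in B, forall j in B, ~~ D i j]
    & [forall i in A, forall j in B, D i j]].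

Lemma layeredP (T : finType) (D : rel T) (A B : {set T}) : reflect
  [/\ {in A &, forall i j, ~~ D i j}, {in B &, forall i j, ~~ D i j}
    & {in A & B, forall i j, D i j}] (layered D A B).
Proof.
apply: (iffP and3P) => [[/forall_inP HA /forall_inP HB /forall_inP HAB]|[HA HB HAB]].
  by split=> i j /[dup] ? => [/HA|/HB|/HAB] /forall_inP; apply.
by split; apply/forall_inP => i iA; apply/forall_inP => j jB; auto.
Qed.

Definition layer_pairs (T : finType) (P r : nat) (D : rel T) :
  {set {set T} * {set T}} :=
  [set X : {set T} * {set T} | [&& #|X.1| == P, #|X.2| == r & layered D X.1 X.2]].

(** Cloning, permuting and deleting elements all replace an order by its pullback
along a map. *)
Lemma layered_pull (T T' : finType) (D : rel T) (h : T' -> T)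
    (A0 B0 : {set T}) (A B : {set T'}) :
  (forall i, i \in A -> h i \in A0) -> (forall i, i \in B -> h i \in B0) ->
  layered D A0 B0 -> layered (fun i j => D (h i) (h j)) A B.
Proof.
move=> hA hB /layeredP[H1 H2 H3].
by apply/layeredP; split=> i j ? ?; [apply: H1|apply: H2|apply: H3]; auto.
Qed.

(** * Symmetrization *)

(** The element [y] is replaced by a copy of the element [x], incomparable to
it.  In a pair of layers, two incomparable elements lie in the same layer, and
elements of one layer have the same relations to the other layer; this is why
pairs through both [x] and [y] survive.  Pairs through [x] alone survive and
gain a twin in which [y] plays the part of [x]; only the pairs through [y] alone
are lost. *)
Section Clone.
Variables (T : finType) (P r : nat) (D : rel T) (x y : T).
Hypotheses (nDxy : ~~ D x y) (nDyx : ~~ D y x).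

Let phi (i : T) := if i == y then x else i.

Definition clone : rel T := fun i j => D (phi i) (phi j).

Definition through (z : T) : {set {set T} * {set T}} :=
  [set X : {set T} * {set T} | z \in X.1 :|: X.2].

Let N (E : rel T) := layer_pairs P r E.

Lemma clone_none :
  N D :\: through x :\: through y \subset N clone :\: through x :\: through y.
Proof.
apply/fintype.subsetP => -[A B]; rewrite !inE /=.
case/and3P => ny nx /and3P[cA cB lAB]; rewrite ny nx cA cB /=.
apply: layered_pull lAB => i iAB; rewrite /phi;
  case: eqP => // ei; by rewrite -ei iAB ?orbT in ny.
Qed.

Lemma clone_one :
  (N D :&: through x) :\: through y \subset (N clone :&: through x) :\: through y.
Proof.
apply/fintype.subsetP => -[A B]; rewrite !inE /=.
case/and3P => ny /and3P[cA cB lAB] nx; rewrite ny nx cA cB andbT /=.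
apply: layered_pull lAB => i iAB; rewrite /phi;
  case: eqP => // ei; by rewrite -ei iAB ?orbT in ny.
Qed.

Lemma clone_both :
  N D :&: through x :&: through y \subset N clone :&: through x :&: through y.
Proof.
apply/fintype.subsetP => -[A B]; rewrite !inE /=.
case/andP=> /andP[/and3P[cA cB lAB] xAB] yAB; rewrite xAB yAB cA cB !andbT /=.
have /layeredP[_ _ H] := lAB.
apply: layered_pull lAB => i iAB; rewrite /phi;
  case: eqP => // ei; rewrite ei in iAB.
  case/orP: xAB => // xB; by case/negP: nDyx; apply: H.
case/orP: xAB => // xA; by case/negP: nDxy; apply: H.
Qed.

Lemma clone_swap :
  #|(N D :&: through x) :\: through y| <= #|(N clone :\: through x) :&: through y|.
Proof.
pose s := tperm x y; pose F (X : {set T} * {set T}) := (s @: X.1, s @: X.2).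
have injF : injective F.
  by move=> [A B] [A' B'] [] /(imset_inj (@perm_inj _ s)) ->
     /(imset_inj (@perm_inj _ s)) ->.
rewrite -(card_imset _ injF); apply/subset_leq_card/fintype.subsetP.
move=> _ /imsetP[[A B] + ->]; rewrite !inE /= => /and3P[ny /and3P[cA cB lAB] nx].
have memI (C : {set T}) z : (z \in s @: C) = (s z \in C).
  by rewrite -{1}(tpermK x y z) mem_imset //; apply: perm_inj.
rewrite !memI tpermL tpermR ny nx !card_imset; try exact: perm_inj.
rewrite cA cB andbT /=.
apply: layered_pull lAB => i; rewrite memI /phi /s;
  case: tpermP => [->|->|/eqP nx' /eqP ny'].
- by move=> yA; rewrite yA ?orbT in ny.
- by rewrite eqxx.
- by rewrite (negbTE ny').
- by move=> yA; rewrite yA ?orbT in ny.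
- by rewrite eqxx.
- by rewrite (negbTE ny').
Qed.

Lemma card_through (E : rel T) :
  #|N E| = #|N E :&: through x :&: through y| + #|(N E :&: through x) :\: through y|
         + (#|(N E :\: through x) :&: through y|
         + #|N E :\: through x :\: through y|).
Proof. by rewrite !cardsID. Qed.

Lemma clone_gain :
  #|N D| + #|(N D :&: through x) :\: through y|
    <= #|N clone| + #|(N D :\: through x) :&: through y|.
Proof.
rewrite !card_through.
have := subset_leq_card clone_none; have := subset_leq_card clone_one.
have := subset_leq_card clone_both; have := clone_swap.
lia.
Qed.

End Clone.

(** In an irreflexive relation twins are unrelated.  The converse, that unrelated
elements are twins, characterizes the weak orders among the strict orders. *)
Definition twin (T : finType) (D : rel T) : rel T := fun i j =>
  [forall z, (D i z == D j z) && (D z i == D z j)].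

Lemma twinP (T : finType) (D : rel T) i j :
  reflect (forall z, D i z = D j z /\ D z i = D z j) (twin D i j).
Proof.
apply: (iffP forallP) => H z; first by case/andP: (H z) => /eqP ? /eqP ?.
by have [-> ->] := H z; rewrite !eqxx.
Qed.

Lemma twin_refl (T : finType) (D : rel T) : reflexive (twin D).
Proof. by move=> i; apply/twinP. Qed.

Lemma twin_sym (T : finType) (D : rel T) : symmetric (twin D).
Proof.
by move=> i j; apply/twinP/twinP => H z; have [-> ->] := H z.
Qed.

Lemma twin_trans (T : finType) (D : rel T) : transitive (twin D).
Proof.
move=> j i k /twinP H1 /twinP H2; apply/twinP => z.
by have [-> ->] := H1 z; apply: H2.
Qed.

Definition twins (T : finType) (D : rel T) i : {set T} := [set j | twin D i j].

Definition twin_count (T : finType) (D : rel T) : nat := \sum_i #|twins D i|.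

Lemma twin_count_le (T : finType) (D : rel T) : twin_count D <= #|T| * #|T|.
Proof. by rewrite -sum_nat_const; apply: leq_sum => i _; apply: max_card. Qed.

(** The element [y] leaves its own class of twins and joins the class of [x];
other pairs of twins remain twins.  The number of ordered pairs of twins is the
sum of the squares of the class sizes, and it increases when an element moves
to a class at least as large as its own. *)
Lemma clone_twin_count (T : finType) (D : rel T) (x y : T) :
  ~~ twin D x y -> #|twins D y| <= #|twins D x| ->
  twin_count D < twin_count (clone D x y).
Proof.
move=> nxy leYX; set E := clone D x y.
have twinE i j : twin D (if i == y then x else i) (if j == y then x else j) ->
    twin E i j.
  by move=> /twinP H; apply/twinP => z; apply: H.
have cardY : #|twins E y| >= #|twins D x| + 1.
  have -> : #|twins D x| + 1 = #|y |: twins D x| by rewrite cardsU1 inE nxy addnC.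
  apply/subset_leq_card/fintype.subsetP => j; rewrite !inE => jYX; apply: twinE.
  rewrite eqxx; case: eqP jYX => //= _ _; exact: twin_refl.
have card_other i : i != y ->
    #|twins D i| + twin D i x <= #|twins E i| + twin D i y.
  move=> neiy; have [ix|nix] := boolP (twin D i x).
    have niy : twin D i y = false.
      by apply: contraNF nxy; apply: twin_trans; rewrite twin_sym.
    have -> : #|twins D i| + true = #|y |: twins D i|.
      by rewrite cardsU1 inE niy addnC.
    rewrite niy addn0; apply/subset_leq_card/fintype.subsetP => j.
    rewrite !inE => jYX; apply: twinE; rewrite (negbTE neiy).
    by case: eqP jYX.
  have yE : (y \in twins D i) = twin D i y by rewrite inE.
  rewrite addn0 (cardsD1 y) yE addnC leq_add2r.
  apply/subset_leq_card/fintype.subsetP => j; rewrite !inE => /andP[nejy ij].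
  by apply: twinE; rewrite (negbTE neiy) (negbTE nejy).
rewrite /twin_count (bigD1 y) //= [X in _ < X](bigD1 y) //=.
have sum_other : \sum_(i | i != y) #|twins D i| + \sum_(i | i != y) twin D i x
    <= \sum_(i | i != y) #|twins E i| + \sum_(i | i != y) twin D i y.
  by rewrite -!big_split; apply: leq_sum.
have sum_x : \sum_(i | i != y) twin D i x = #|twins D x|.
  rewrite -sum1_card [RHS]big_mkcond [RHS](bigD1 y) //= inE (negbTE nxy) add0n.
  by apply: eq_bigr => i _; rewrite inE twin_sym; case: twin.
have sum_y : (\sum_(i | i != y) twin D i y).+1 = #|twins D y|.
  rewrite -sum1_card [RHS]big_mkcond [RHS](bigD1 y) //= inE twin_refl add1n.
  by congr _.+1; apply: eq_bigr => i _; rewrite inE twin_sym; case: twin.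
lia.
Qed.

Section Symmetrize.
Variables (T : finType) (P r : nat).

(** Lexicographic combination of the number of layer pairs and the number of
pairs of twins, which is at most [#|T| ^ 2]. *)
Definition weight (D : rel T) : nat :=
  #|layer_pairs P r D| * (#|T| * #|T|).+1 + twin_count D.

Lemma weight_le (D : rel T) :
  weight D <= #|{: {set T} * {set T}}| * (#|T| * #|T|).+1 + #|T| * #|T|.
Proof.
by rewrite leq_add ?twin_count_le // leq_mul2r max_card orbT.
Qed.

(** [N10] counts the pairs through [x] alone and [N01] those through [y] alone.
If [N10] is larger, copying [x] yields more pairs of layers; if they agree, the
number of these pairs does not decrease, and [y] moves to a class of twins at
least as large as its own. *)
Lemma clone_weight (D : rel T) (x y : T) :
  ~~ D x y -> ~~ D y x -> ~~ twin D x y ->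
  let N10 := #|(layer_pairs P r D :&: through x) :\: through y| in
  let N01 := #|(layer_pairs P r D :\: through x) :&: through y| in
  (N01 < N10) || (N01 == N10) && (#|twins D y| <= #|twins D x|) ->
  #|layer_pairs P r D| <= #|layer_pairs P r (clone D x y)| /\
  weight D < weight (clone D x y).
Proof.
move=> nDxy nDyx nxy N10 N01 better.
have gain := clone_gain P r nDxy nDyx; rewrite -/N10 -/N01 in gain.
split; first by case/orP: better => [|/andP[/eqP]]; lia.
rewrite /weight; case/orP: better => [lt01|/andP[/eqP e01 leYX]].
  have := twin_count_le D; set t := twin_count D; set t' := twin_count _.
  set a := #|layer_pairs P r D| in gain *.
  set b := #|layer_pairs P r _| in gain * => le_t.
  have : a.+1 * (#|T| * #|T|).+1 <= b * (#|T| * #|T|).+1 by rewrite leq_mul2r; lia.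
  by rewrite mulSn; lia.
have := clone_twin_count nxy leYX.
suff : #|layer_pairs P r D| * (#|T| * #|T|).+1 <=
   #|layer_pairs P r (clone D x y)| * (#|T| * #|T|).+1 by lia.
by rewrite leq_mul2r; lia.
Qed.

(** If unrelated elements are twins, a strict order is the comparison of the
numbers of predecessors. *)
Lemma weak_order_rank (D : rel T) : irreflexive D -> transitive D ->
  (forall x y, ~~ D x y -> ~~ D y x -> twin D x y) ->
  forall i j, D i j = (#|[set k | D k i]| < #|[set k | D k j]|).
Proof.
move=> irrD transD twinD.
have mono i j : D i j -> #|[set k | D k i]| < #|[set k | D k j]|.
  move=> Dij; apply/proper_card/properP; split.
    by apply/fintype.subsetP => k; rewrite !inE => /transD; apply.
  by exists i; rewrite inE ?irrD.
move=> i j; apply/idP/idP; first exact: mono.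
apply: contraTT => nDij; have [/mono/ltnW|nDji] := boolP (D j i).
  by rewrite -leqNgt.
have /twinP tw := twinD _ _ nDij nDji.
by rewrite -leqNgt; apply/eq_leq/eq_card => k; rewrite !inE; have [_ ->] := tw k.
Qed.

Lemma rank_lt (D : rel T) (i : T) : irreflexive D -> #|[set k | D k i]| < #|T|.
Proof.
move=> irrD; rewrite -cardsT; apply/proper_card/properP.
by split; [exact: finset.subsetT | exists i; rewrite inE ?irrD].
Qed.

(** An order that cannot be improved by cloning has only twins as unrelated
pairs, and is therefore a weak order.  The bounded weight makes the process
stop. *)
Lemma symmetrize (D : rel T) : irreflexive D -> transitive D ->
  exists f : T -> nat, (forall i, f i < #|T|) /\
    #|layer_pairs P r D| <= #|layer_pairs P r (fun i j => f i < f j)|.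
Proof.
have [m] := ubnP (#|{: {set T} * {set T}}| * (#|T| * #|T|).+1 + #|T| * #|T| - weight D).
elim: m D => // m IHm D le_m irrD transD.
have step x y : weight D < weight (clone D x y) ->
    #|layer_pairs P r D| <= #|layer_pairs P r (clone D x y)| ->
    exists f : T -> nat, (forall i, f i < #|T|) /\
    #|layer_pairs P r D| <= #|layer_pairs P r (fun i j => f i < f j)|.
  move=> ltW leN; have [|||f [ltf lef]] := IHm (clone D x y).
  - by have := weight_le (clone D x y); lia.
  - by move=> i; apply: irrD.
  - by move=> j i k; apply: transD.
  by exists f; split=> //; apply: leq_trans lef.
have [[x [y [nxy nyx ntw]]]|twinD] :=
  pselect (exists x y, [/\ ~~ D x y, ~~ D y x & ~~ twin D x y]).
  pose N10 := #|(layer_pairs P r D :&: through x) :\: through y|.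
  pose N01 := #|(layer_pairs P r D :\: through x) :&: through y|.
  have [better|worse] :=
    boolP ((N01 < N10) || (N01 == N10) && (#|twins D y| <= #|twins D x|)).
    by have [? ?] := clone_weight nxy nyx ntw better; apply: (step x y).
  have ntw' : ~~ twin D y x by rewrite twin_sym.
  have only_y : (layer_pairs P r D :&: through y) :\: through x =
      (layer_pairs P r D :\: through x) :&: through y.
    by apply/setP => X; rewrite !inE !andbA.
  have only_x : (layer_pairs P r D :\: through y) :&: through x =
      (layer_pairs P r D :&: through x) :\: through y.
    by apply/setP => X; rewrite !inE !andbA.
  have := clone_weight nyx nxy ntw'; rewrite only_x only_y -/N10 -/N01.
  have better : (N10 < N01) || (N10 == N01) && (#|twins D x| <= #|twins D y|).
    by move: worse; lia.
  by move=> /(_ better) [? ?]; apply: (step y x).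
exists (fun i => #|[set k | D k i]|); split; first by move=> i; apply: rank_lt.
apply/eq_leq/eq_card => X; rewrite !inE; congr [&& _, _ & _].
congr layered; apply: boolp.funext => i; apply: boolp.funext => j;
  apply: weak_order_rank => //.
move=> x y nxy nyx; apply: contrapT => /negP ntw.
by apply: twinD; exists x, y.
Qed.
End Symmetrize.

(** * Extremal counts of two-layer permutations *)

(** In a weak order an antichain is contained in one class.  Positivity of [P]
and [r] makes the two classes unique. *)
Lemma card_layer_pairs n (P r : nat) (f : 'I_n -> 'I_n) : 0 < P -> 0 < r ->
  #|layer_pairs P r (fun i j => f i < f j)| =
  pair_sum (fun t => 'C(t, P)) (fun t => 'C(t, r)) f.
Proof.
move=> P_gt0 r_gt0.
rewrite /pair_sum (pair_big_dep predT (fun x y : 'I_n => x < y)) /=.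
pose O (z : 'I_n * 'I_n) := finset.setX (draws (fiber f z.1) P) (draws (fiber f z.2) r).
transitivity (\sum_(z : 'I_n * 'I_n | z.1 < z.2) #|O z|); last first.
  by apply: eq_bigr => z _; rewrite cardsX !cards_draws.
have memO z X : X \in O z -> [/\ #|X.1| = P, #|X.2| = r,
    forall i, i \in X.1 -> f i = z.1 & forall i, i \in X.2 -> f i = z.2].
  case: X => A B; rewrite finset.in_setX 2!inE => /andP[/andP[/fintype.subsetP s1 /eqP ->]].
  move=> /andP[/fintype.subsetP s2 /eqP ->].
  by split=> // i; [move/s1|move/s2]; rewrite inE => /eqP.
have pick_elt (A : {set 'I_n}) k : #|A| = k -> 0 < k -> exists i, i \in A.
  by move=> cA k_gt0; apply/set0Pn; rewrite -cards_eq0 cA -lt0n.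
apply: card_disjoint_cover => [z X ltz|X|z z' X _ _].
- case/memO => c1 c2 f1 f2; rewrite inE c1 c2 !eqxx /=.
  apply/layeredP; split=> i j.
  + by move=> /f1 -> /f1 ->; rewrite ltnn.
  + by move=> /f2 -> /f2 ->; rewrite ltnn.
  + by move=> /f1 -> /f2 ->.
- case: X => A B; rewrite inE /= => /and3P[/eqP c1 /eqP c2 /layeredP[H1 H2 H3]].
  have [a aA] := pick_elt _ _ c1 P_gt0; have [b bB] := pick_elt _ _ c2 r_gt0.
  exists (f a, f b); first exact: H3.
  rewrite finset.in_setX 2!inE c1 c2 !eqxx !andbT.
  have same i j : ~~ (f i < f j) -> ~~ (f j < f i) -> f i == f j.
    by rewrite -!leqNgt => leji leij; rewrite -val_eqE eqn_leq leij leji.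
  by apply/andP; split; apply/fintype.subsetP => i iX; rewrite inE;
    apply: same; by [apply: H1 | apply: H2].
- move=> /memO[c1 c2 f1 f2] /memO[_ _ g1 g2].
  have [a aA] := pick_elt _ _ c1 P_gt0; have [b bB] := pick_elt _ _ c2 r_gt0.
  by case: z z' f1 f2 g1 g2 => [x y] [x' y'] /= f1 f2 g1 g2;
    rewrite -(f1 a) // -(g1 a) // -(f2 b) // -(g2 b).
Qed.

Lemma layer_pairs_le n (P r : nat) (D : rel 'I_n) : 0 < P -> 0 < r ->
  irreflexive D -> transitive D ->
  #|layer_pairs P r D| <= max_pair_sum n (fun t => 'C(t, P)) (fun t => 'C(t, r)).
Proof.
move=> P_gt0 r_gt0 irrD transD.
have [f [ltf lef]] := symmetrize P r irrD transD.
have ltf' i : f i < n by rewrite -[n in _ < n]card_ord.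
apply: leq_trans lef _; apply: leq_trans (max_pair_sum_ge _ _ (fun i => Ordinal (ltf' i))).
by rewrite -card_layer_pairs.
Qed.

Lemma size_layered2 (P r : nat) : size (layered2 P r) = P + r.
Proof. by rewrite size_cat !size_rev !size_iota. Qed.

Lemma nth_layered2_lo (P r k : nat) : k < P -> nth 0 (layered2 P r) k = P - k.
Proof.
move=> ltkP; rewrite nth_cat size_rev size_iota ltkP.
by rewrite nth_rev size_iota ?nth_iota; lia.
Qed.

Lemma nth_layered2_hi (P r k : nat) : P <= k -> k < P + r ->
  nth 0 (layered2 P r) k = P + r - (k - P).
Proof.
move=> lePk ltk; rewrite nth_cat size_rev size_iota ltnNge lePk /=.
by rewrite nth_rev size_iota ?nth_iota; lia.
Qed.

(** The first [P] positions of an occurrence form the lower layer: their letters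
decrease, so none is below another one in the order by position and letter.  The
same holds for the last [r] positions. *)
Lemma occ_layered_le n (P r : nat) (g : 'I_n -> nat) :
  #|occ (layered2 P r) g| <=
  #|layer_pairs P r (fun i j : 'I_n => (i < j) && (g i < g j))|.
Proof.
pose U (X : {set 'I_n} * {set 'I_n}) := X.1 :|: X.2.
apply: leq_trans (leq_imset_card U _); apply/subset_leq_card/fintype.subsetP => S.
rewrite inE => /order_isoP[]; rewrite size_map size_layered2 => sz iso.
have := esym (cat_take_drop P (enum S)) => /enum_split[A [B [eqS eA eB ltAB]]].
have cA : #|A| = P by rewrite cardE eA size_takel // -sz leq_addr.
have cB : #|B| = r by rewrite cardE eB size_drop -sz addKn.
have iS i : i \in A :|: B -> i \in enum S by rewrite mem_enum eqS.
have idxA i : i \in A -> index i (enum S) < P.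
  move=> iA; rewrite -in_take; first by rewrite -eA mem_enum.
  by apply: iS; rewrite inE iA.
have idxB i : i \in B -> P <= index i (enum S).
  move=> iB; rewrite leqNgt -in_take; last by apply: iS; rewrite inE iB orbT.
  rewrite -eA mem_enum; apply/negP => iA.
  by have := ltAB _ _ iA iB; rewrite ltnn.
have idx_lt i : i \in A :|: B -> index i (enum S) < P + r.
  by move=> /iS; rewrite -index_mem sz.
have idx_mono i j : i \in A :|: B -> j \in A :|: B -> i < j ->
    index i (enum S) < index j (enum S).
  move=> /iS iS' /iS jS' ltij; rewrite ltnNge leq_eqVlt; apply/negP => /orP[/eqP e|lt].
    have eij : j = i by rewrite -(nth_index i iS') -e nth_index.
    by rewrite eij ltnn in ltij.
  have := sorted_ltn_index (@ord_lt_trans n) (sorted_enum S) _ _ jS' iS' lt.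
  by rewrite /ord_lt; lia.
have isoE i j : i \in A :|: B -> j \in A :|: B ->
    (g i < g j) = (nth 0 (layered2 P r) (index i (enum S))
                     < nth 0 (layered2 P r) (index j (enum S))).
  move=> iU jU; rewrite iso ?idx_lt // !(nth_map i) ?index_mem ?iS //.
  by rewrite !nth_index ?iS.
apply/imsetP; exists (A, B); last by rewrite /U.
rewrite inE /= cA cB !eqxx /=; apply/layeredP; split=> i j iX jX.
- apply/negP => /andP[ltij]; rewrite isoE ?inE ?iX ?jX //.
  have ilt := idxA _ iX; have jlt := idxA _ jX.
  have := idx_mono i j; rewrite !inE iX jX => /(_ isT isT ltij).
  by rewrite !nth_layered2_lo //; lia.
- apply/negP => /andP[ltij]; rewrite isoE ?inE ?iX ?jX ?orbT //.
  have ige := idxB _ iX; have jge := idxB _ jX.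
  have := idx_lt i; have := idx_lt j; have := idx_mono i j.
  rewrite !inE iX jX !orbT => /(_ isT isT ltij) ? /(_ isT) ? /(_ isT) ?.
  by rewrite !nth_layered2_hi //; lia.
- rewrite ltAB // isoE ?inE ?iX ?jX ?orbT //=.
  have := idxB _ jX; have := idxA _ iX; have := idx_lt j; rewrite inE jX orbT.
  move: (index i _) (index j _) => a b /(_ isT) ? ? ?.
  by rewrite nth_layered2_lo // nth_layered2_hi //; lia.
Qed.

Lemma layer_pairs_perm (T : finType) (P r : nat) (D : rel T) (s : {perm T}) :
  #|layer_pairs P r D| <= #|layer_pairs P r (fun i j => D (s i) (s j))|.
Proof.
pose F (X : {set T} * {set T}) := (s @^-1: X.1, s @^-1: X.2).
have pre_inj : injective (fun A : {set T} => s @^-1: A).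
  move=> A A' /setP eA; apply/setP => i.
  by have := eA (s^-1%g i); rewrite !inE permKV.
have injF : injective F by move=> [A B] [A' B'] [] /pre_inj -> /pre_inj ->.
rewrite -(card_imset _ injF); apply/subset_leq_card/fintype.subsetP.
move=> _ /imsetP[[A B] + ->]; rewrite !inE /= => /and3P[cA cB lAB].
rewrite !card_preimset; try exact: perm_inj.
rewrite cA cB; apply: layered_pull lAB => i; by rewrite inE.
Qed.

(** The letters of a layered permutation: equal values of [h] are ranked from
right to left, so that each class becomes a decreasing run. *)
Definition reversed_rank n (h : 'I_n -> nat) (i : 'I_n) : nat :=
  #|[set k : 'I_n | (h k < h i) || (h k == h i) && (i < k)]|.

Lemma reversed_rankE n (h : 'I_n -> nat) (i j : 'I_n) :
  (reversed_rank h i < reversed_rank h j) =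
  (h i < h j) || (h i == h j) && (j < i).
Proof.
pose D : rel 'I_n := fun i j => (h i < h j) || (h i == h j) && (j < i).
rewrite -[LHS]/(#|[set k | D k i]| < #|[set k | D k j]|).
rewrite -weak_order_rank //.
- by move=> a; rewrite /D; lia.
- by move=> a b c; rewrite /D; lia.
- move=> a b; rewrite /D => nab nba.
  have -> : a = b by apply: val_inj => /=; lia.
  exact: twin_refl.
Qed.

Lemma reversed_rank_lt n (h : 'I_n -> nat) (i : 'I_n) : reversed_rank h i < n.
Proof.
rewrite -[n in _ < n]card_ord.
apply: (@rank_lt _ (fun i j : 'I_n => (h i < h j) || (h i == h j) && (j < i))).
by move=> a; lia.
Qed.

(** The union of the two layers is an occurrence, and it determines them: the
lower layer consists of the elements of the union that are below some other
element of it. *)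
Lemma occ_layered_ge n (P r : nat) (h : 'I_n -> nat) : 0 < P -> 0 < r ->
  {homo h : i j / i <= j} ->
  #|layer_pairs P r (fun i j => h i < h j)| <=
  #|occ (layered2 P r) (reversed_rank h)|.
Proof.
move=> P_gt0 r_gt0 h_mono.
pose U (X : {set 'I_n} * {set 'I_n}) := X.1 :|: X.2.
pose lower (S : {set 'I_n}) := [set i in S | [exists j in S, h i < h j]].
have lowerK : {in layer_pairs P r (fun i j => h i < h j),
    cancel U (fun S => (lower S, S :\: lower S))}.
  move=> [A B]; rewrite inE /= => /and3P[_ /eqP cB /layeredP[H1 H2 H3]].
  have [b bB] : exists b, b \in B by apply/set0Pn; rewrite -cards_eq0 cB -lt0n.
  have lowA i : i \in A -> i \in lower (A :|: B).
    move=> iA; rewrite !inE iA /=; apply/existsP; exists b.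
    by rewrite inE bB orbT H3.
  have lowB i : i \in B -> i \notin lower (A :|: B).
    move=> iB; rewrite !inE iB orbT /=; apply/existsP => -[j].
    rewrite inE => /andP[/orP[jA|jB]]; last by apply/negP/H2.
    by have := H3 _ _ jA iB; lia.
  have eA : lower (A :|: B) = A.
    apply/setP => i; apply/idP/idP; last exact: lowA.
    move=> low; have : i \in A :|: B by move: low; rewrite inE => /andP[].
    by rewrite inE => /orP[] // /lowB; rewrite low.
  rewrite /U /= eA; congr (_, _); apply/setP => i; rewrite !inE.
  have [iA|//] := boolP (i \in A); symmetry; apply: contraTF (lowA _ iA).
  exact: lowB.
rewrite -(card_in_imset (can_in_inj lowerK)).
apply/subset_leq_card/fintype.subsetP => _ /imsetP[[A B] + ->].
rewrite inE /= => /and3P[/eqP cA /eqP cB /layeredP[H1 H2 H3]].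
have hAB : enum (A :|: B) = enum A ++ enum B.
  apply: enum_setU_lt => a b aA bB; have := H3 _ _ aA bB.
  by rewrite /= ltnNge [_ < b]ltnNge; apply: contra => /h_mono.
have sz : size (enum (A :|: B)) = P + r by rewrite hAB size_cat -!cardE cA cB.
have [a aA] : exists a, a \in A by apply/set0Pn; rewrite -cards_eq0 cA -lt0n.
have inA k : k < P -> nth a (enum (A :|: B)) k \in A.
  by move=> ltk; rewrite hAB nth_cat -cardE cA ltk -mem_enum mem_nth // -cardE cA.
have inB k : P <= k -> k < P + r -> nth a (enum (A :|: B)) k \in B.
  move=> lek ltk; rewrite hAB nth_cat -cardE cA ltnNge lek /=.
  by rewrite -mem_enum mem_nth // -cardE cB; lia.
have nth_lt k l : k < P + r -> l < P + r ->
    (nth a (enum (A :|: B)) k < nth a (enum (A :|: B)) l) = (k < l).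
  have mono k' l' : k' < l' -> l' < P + r ->
      nth a (enum (A :|: B)) k' < nth a (enum (A :|: B)) l'.
    move=> ltkl ltl.
    by apply: (sorted_ltn_nth (@ord_lt_trans n) a (sorted_enum (A :|: B)));
      rewrite ?inE ?sz //; lia.
  move=> ltk ltl; case: (ltngtP k l) => [ltkl|ltlk|->].
  - exact: mono.
  - by have := mono l k ltlk ltk; lia.
  - exact: ltnn.
have H1' i j : i \in A -> j \in A -> h i = h j.
  by move=> iA jA; have := H1 _ _ iA jA; have := H1 _ _ jA iA; lia.
have H2' i j : i \in B -> j \in B -> h i = h j.
  by move=> iB jB; have := H2 _ _ iB jB; have := H2 _ _ jB iB; lia.
rewrite /U inE /=; apply/order_isoP; rewrite size_map sz size_layered2.
split=> // k l ltk ltl.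
rewrite !(nth_map a) ?sz // reversed_rankE nth_lt //.
case: (ltnP k P) => kP; case: (ltnP l P) => lP.
- rewrite !nth_layered2_lo // (H1' _ _ (inA _ kP) (inA _ lP)) ltnn eqxx /=; lia.
- rewrite nth_layered2_lo // nth_layered2_hi // H3 ?inA ?inB //=; lia.
- rewrite nth_layered2_hi // nth_layered2_lo //.
  have := H3 _ _ (inA _ lP) (inB _ kP ltk); move: (h _) (h _) => u v; lia.
- rewrite !nth_layered2_hi // (H2' _ _ (inB _ kP ltk) (inB _ lP ltl)) ltnn eqxx /=; lia.
Qed.

Lemma max_nu_layered2 n (P r : nat) : 0 < P -> 0 < r ->
  \max_(s : n.-tuple 'I_n) nu (layered2 P r) (letters s) =
  max_pair_sum n (fun t => 'C(t, P)) (fun t => 'C(t, r)).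
Proof.
move=> P_gt0 r_gt0; apply/eqP; rewrite eqn_leq; apply/andP; split.
  apply/bigmax_leqP => s _; rewrite nu_letters.
  apply: leq_trans (occ_layered_le _ _ _) _; apply: layer_pairs_le => //.
    by move=> i; rewrite ltnn.
  by move=> j i k; lia.
apply/bigmax_leqP => f _; rewrite -card_layer_pairs //.
have [s s_mono] := sort_by_key (fun i => nat_of_ord (f i)).
apply: leq_trans (layer_pairs_perm _ _ _ s) _.
apply: leq_trans (occ_layered_ge _ _ _) _ => //.
pose w := [tuple Ordinal (reversed_rank_lt (fun i => f (s i)) i) | i < n].
apply: leq_trans (leq_bigmax w); rewrite nu_letters.
apply/eq_leq/eq_card => A; rewrite !inE.
by congr order_iso; apply: eq_map => i; rewrite tnth_mktuple.
Qed.

Lemma max_nu12 n (P r : nat) : 0 < P -> 0 < r ->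
  \max_(s : n.-tuple 'I_n) nu (word12 P r) (letters s) =
  max_pair_sum n (fun t => 'C(t, P)) (fun t => 'C(t, r)).
Proof.
move=> P_gt0 r_gt0; rewrite word12E max_nu121 //.
by congr (max_pair_sum n _ _); apply: boolp.funext => t; apply: best_split0.
Qed.

(** * Estimates of binomial coefficients *)

(** A shift by [d] costs only a term of lower degree. *)
Lemma expn_gap (d k t : nat) : t ^ k <= (t - d) ^ k + k * d * t ^ k.-1.
Proof.
elim: k => // k IHk; rewrite expnS.
case: k IHk => [|k] IHk /=; first by rewrite !expn1 expn0; lia.
have le_dt : (t - d) ^ k.+1 <= t ^ k.+1 by rewrite leq_exp2r ?leq_subr.
have : t * t ^ k.+1 <= t * ((t - d) ^ k.+1 + k.+1 * d * t ^ k).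
  by rewrite leq_mul2l IHk orbT.
have : t * (t - d) ^ k.+1 <= (t - d) ^ k.+2 + d * (t - d) ^ k.+1.
  by rewrite [_ ^ k.+2]expnS -mulnDl leq_mul2r; apply/orP; right; lia.
have : d * (t - d) ^ k.+1 <= d * t ^ k.+1 by rewrite leq_mul2l le_dt orbT.
have -> : t * ((t - d) ^ k.+1 + k.+1 * d * t ^ k) =
    t * (t - d) ^ k.+1 + k.+1 * d * t ^ k.+1 by rewrite [t ^ k.+1]expnS; lia.
lia.
Qed.

Lemma ffact_le_expn (t k : nat) : t ^_ k <= t ^ k.
Proof.
by elim: k => // k IHk; rewrite ffactnSr expnSr leq_mul // leq_subr.
Qed.

Lemma expn_le_ffact (t k : nat) : (t.+1 - k) ^ k <= t ^_ k.
Proof.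
elim: k => // k IHk; rewrite subSS ffactnSr expnSr leq_mul //.
by apply: leq_trans IHk; case: k => // k; rewrite leq_exp2r //; lia.
Qed.

Lemma bin_le (k t : nat) : k`! * 'C(t, k) <= t ^ k.
Proof. by rewrite mulnC bin_ffact ffact_le_expn. Qed.

Lemma bin_ge (k t : nat) : (t - k) ^ k <= k`! * 'C(t, k).
Proof.
rewrite mulnC bin_ffact; apply: leq_trans (expn_le_ffact _ _).
by case: k => // k; rewrite leq_exp2r //; lia.
Qed.

(** The unweighted inequality is applied to [p] copies of [u / p] and [q] copies
of [v / q], whose sum is [u + v]. *)
Lemma weighted_AGM (p q u v : nat) : 0 < p -> 0 < q ->
  (p + q) ^ (p + q) * (u ^ p * v ^ q) <= p ^ p * q ^ q * (u + v) ^ (p + q).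
Proof.
move=> p_gt0 q_gt0.
pose E (i : 'I_(p + q)) : rat :=
  (if (i < p)%N then u%:R / p%:R else v%:R / q%:R)%R.
have p0 : (p%:R != 0 :> rat)%R by rewrite pnatr_eq0 -lt0n.
have q0 : (q%:R != 0 :> rat)%R by rewrite pnatr_eq0 -lt0n.
have pq0 : ((p + q)%:R != 0 :> rat)%R by rewrite pnatr_eq0; lia.
have E_ge0 : {in 'I_(p + q), forall i, (0 <= E i)%R}.
  by move=> i _; rewrite /E; case: ifP => _; rewrite divr_ge0 ?ler0n.
have [+ _] := leif_AGM E_ge0.
rewrite card_ord !big_split_ord /=.
have El i : E (lshift q i) = (u%:R / p%:R)%R by rewrite /E /= ltn_ord.
have Er i : E (rshift p i) = (v%:R / q%:R)%R.
  by rewrite /E /= ltnNge leq_addr.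
under eq_bigr do rewrite El; rewrite prodr_const card_ord.
under eq_bigr do rewrite Er; rewrite prodr_const card_ord.
under eq_bigr do rewrite El; rewrite sumr_const card_ord.
under eq_bigr do rewrite Er; rewrite sumr_const card_ord.
have -> : (u%:R / p%:R *+ p = u%:R :> rat)%R by rewrite -mulr_natr divfK.
have -> : (v%:R / q%:R *+ q = v%:R :> rat)%R by rewrite -mulr_natr divfK.
rewrite -natrD 3!expr_div_n.
rewrite mulf_div ler_pdivrMr; last by rewrite mulr_gt0 // exprn_gt0 // ltr0n.
rewrite mulrAC ler_pdivlMr; last by rewrite exprn_gt0 // ltr0n; lia.
by rewrite -!natrX -!natrM ler_nat; lia.
Qed.

Section Split.
Variables (p q : nat).
Hypotheses (p_gt0 : 0 < p) (q_gt0 : 0 < q).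

Lemma best_split_le (t : nat) :
  (p + q) ^ (p + q) * (p`! * q`!) * best_split p q t
    <= p ^ p * q ^ q * t ^ (p + q).
Proof.
have [u leut ->] := best_splitP p q t.
have := weighted_AGM u (t - u) p_gt0 q_gt0; rewrite subnKC //.
apply: leq_trans; rewrite -mulnA leq_mul2l.
have -> : p`! * q`! * ('C(u, p) * 'C(t - u, q)) = u ^_ p * (t - u) ^_ q.
  by rewrite -!bin_ffact; lia.
by rewrite leq_mul ?orbT // ffact_le_expn.
Qed.

(** With [u = floor(p t / (p + q))] the integers [u + 1 - p] and [t - u + 1 - q],
which bound from below all factors of the two falling factorials, are at least
[p] and [q] times [(t - (p + q)) / (p + q)]. *)
Lemma best_split_ge (t : nat) :
  p ^ p * q ^ q * (t - (p + q)) ^ (p + q)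
    <= (p + q) ^ (p + q) * (p`! * q`!) * best_split p q t.
Proof.
pose u := p * t %/ (p + q).
have pq_gt0 : 0 < p + q by lia.
have leu : u * (p + q) <= p * t by apply: leq_divM.
have ltu : p * t < u.+1 * (p + q) by apply: ltn_ceil.
have leut : u <= t.
  by rewrite -(leq_pmul2r pq_gt0); apply: leq_trans leu _; lia.
have := @best_split_max p q t u (t - u); rewrite subnKC // => /(_ (leqnn t)) le_split.
apply: (@leq_trans ((p + q) ^ (p + q) * (u ^_ p * (t - u) ^_ q))); last first.
  rewrite -mulnA leq_mul2l; apply/orP; right.
  rewrite -!bin_ffact; apply: leq_trans (_ : p`! * q`! * ('C(u, p) * 'C(t - u, q)) <= _).
    by lia.
  by rewrite leq_mul2l le_split orbT.
have lo_u : p * (t - (p + q)) <= (u.+1 - p) * (p + q).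
  by rewrite mulnBr mulnBl leq_sub2r // ltnW.
have lo_v : q * (t - (p + q)) <= ((t - u).+1 - q) * (p + q).
  rewrite mulnBr mulnBl leq_sub2r // mulSn mulnBl; lia.
apply: (@leq_trans (((u.+1 - p) * (p + q)) ^ p * (((t - u).+1 - q) * (p + q)) ^ q)).
  apply: (@leq_trans ((p * (t - (p + q))) ^ p * (q * (t - (p + q))) ^ q)).
    by rewrite !expnMn expnD; lia.
  by rewrite leq_mul // leq_exp2r.
rewrite !expnMn mulnACA [_ * (_ * _)]mulnC expnD leq_mul2l; apply/orP; right.
by rewrite leq_mul // expn_le_ffact.
Qed.

End Split.

(** * Asymptotic comparison of the maxima *)

Lemma sum_card_fiber n (f : 'I_n -> 'I_n) : \sum_x #|fiber f x| = n.
Proof.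
rewrite -[RHS]card_ord -cardsT (@card_disjoint_cover _ _ predT _ (fiber f)) //.
- by move=> i _; exists (f i); rewrite ?inE.
- by move=> x y i _ _; rewrite !inE => /eqP <- /eqP.
Qed.

Lemma sum_expn_le (I : finType) (F : I -> nat) (j : nat) : 0 < j ->
  \sum_i F i ^ j <= (\sum_i F i) ^ j.
Proof.
case: j => // j _; rewrite [leqRHS]expnS big_distrl /=.
apply: leq_sum => i _; rewrite expnS leq_mul2l; apply/orP; right.
have le_sum : F i <= \sum_i F i by rewrite (bigD1 i) //= leq_addr.
by case: j => // j; rewrite leq_exp2r.
Qed.

(** The errors add up to at most [K * n ^ (j + r)] because the letter counts sum
to [n], so that the sum of their [j]-th powers is at most [n ^ j]. *)
Lemma max_pair_sum_close n (a b c : nat -> nat) (K j r : nat) : 0 < j -> 0 < r ->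
  (forall t, a t <= b t + K * t ^ j) -> (forall t, c t <= t ^ r) ->
  max_pair_sum n a c <= max_pair_sum n b c + K * n ^ (j + r).
Proof.
move=> j_gt0 r_gt0 le_ab le_c; apply/bigmax_leqP => f _.
apply: leq_trans (leq_add (max_pair_sum_ge b c f) (leqnn _)).
apply: (@leq_trans (pair_sum b c f + \sum_x \sum_y K * #|fiber f x| ^ j * #|fiber f y| ^ r)).
  rewrite -big_split; apply: leq_sum => x _ /=.
  rewrite [X in _ + X](bigID (fun y : 'I_n => x < y)) /= addnA.
  apply: leq_trans (leq_addr _ _); rewrite -big_split; apply: leq_sum => y _ /=.
  apply: (@leq_trans ((b #|fiber f x| + K * #|fiber f x| ^ j) * c #|fiber f y|)).
    by rewrite leq_mul2r le_ab orbT.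
  by rewrite mulnDl leq_add2l leq_mul2l le_c orbT.
rewrite leq_add2l.
under eq_bigr do rewrite -big_distrr /=.
rewrite -big_distrl -big_distrr /= -mulnA leq_mul2l expnD; apply/orP; right.
by rewrite leq_mul // -[n in n ^ _](sum_card_fiber f) sum_expn_le.
Qed.

Lemma max_pair_sum_scale n (Q : nat) (a c : nat -> nat) :
  max_pair_sum n (fun t => Q * a t) c = Q * max_pair_sum n a c.
Proof.
rewrite /max_pair_sum (big_morph (muln Q) (maxnMr Q) (muln0 Q)).
apply: eq_bigr => f _; rewrite /pair_sum big_distrr; apply: eq_bigr => x _ /=.
by rewrite big_distrr; apply: eq_bigr => y _ /=; rewrite mulnA.
Qed.

Lemma layer_pairs_delete n (P r : nat) (D : rel 'I_n.+1) (i : 'I_n.+1) :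
  #|[set X in layer_pairs P r D | i \notin X.1 :|: X.2]| <=
  #|layer_pairs P r (fun j k : 'I_n => D (lift i j) (lift i k))|.
Proof.
pose F (X : {set 'I_n.+1} * {set 'I_n.+1}) := (lift i @^-1: X.1, lift i @^-1: X.2).
have liftK (A : {set 'I_n.+1}) : i \notin A -> lift i @: (lift i @^-1: A) = A.
  move=> niA; apply/setP => j; apply/imsetP/idP => [[k + ->]|jA].
    by rewrite inE.
  case: (unliftP i j) => [k ej|ej]; last by rewrite ej (negbTE niA) in jA.
  by exists k => //; rewrite inE -ej.
pose G (Y : {set 'I_n} * {set 'I_n}) := (lift i @: Y.1, lift i @: Y.2).
have FK : {in [set X in layer_pairs P r D | i \notin X.1 :|: X.2], cancel F G}.
  move=> [A B]; rewrite inE => /andP[_]; rewrite /= inE negb_or => /andP[nA nB].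
  by rewrite /F /G /= !liftK.
rewrite -(card_in_imset (can_in_inj FK)); apply/subset_leq_card/fintype.subsetP.
move=> _ /imsetP[[A B] + ->]; rewrite !inE /= negb_or.
case/andP=> /and3P[/eqP cA /eqP cB lAB] /andP[nA nB].
rewrite -(card_imset _ (@lift_inj _ i)) liftK // cA eqxx.
rewrite -(card_imset _ (@lift_inj _ i)) liftK // cB eqxx.
by apply: layered_pull lAB => j; rewrite inE.
Qed.

(** Double counting of the layer pairs that avoid a given element: each pair
avoids [n.+1 - (P + r)] elements, and the pairs that avoid [i] live in an order
on [n] elements.  That order is again covered by the maximum over words with
[n] letters. *)
Lemma max_pair_sum_delete n (P r : nat) : 0 < P -> 0 < r ->
  (n.+1 - (P + r)) * max_pair_sum n.+1 (fun t => 'C(t, P)) (fun t => 'C(t, r))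
    <= n.+1 * max_pair_sum n (fun t => 'C(t, P)) (fun t => 'C(t, r)).
Proof.
move=> P_gt0 r_gt0.
have [|f ef] := @bigop.eq_bigmax {ffun 'I_n.+1 -> 'I_n.+1}
  (fun f => pair_sum (fun t => 'C(t, P)) (fun t => 'C(t, r)) f).
  by apply/card_gt0P; exists [ffun=> ord0].
rewrite /max_pair_sum ef -/(max_pair_sum n _ _) -card_layer_pairs //.
set D : rel 'I_n.+1 := fun i j => f i < f j.
have size_pair X : X \in layer_pairs P r D -> #|X.1 :|: X.2| = P + r.
  rewrite inE => /and3P[/eqP cA /eqP cB /layeredP[H1 _ H3]].
  rewrite cardsU cA cB (_ : X.1 :&: X.2 = finset.set0) ?cards0 ?subn0 //.
  apply/setP => i; rewrite !inE; apply/negP => /andP[iA iB].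
  by have := H3 _ _ iA iB; apply/negP/H1.
have -> : (n.+1 - (P + r)) * #|layer_pairs P r D| =
    \sum_(i < n.+1) #|[set X in layer_pairs P r D | i \notin X.1 :|: X.2]|.
  under eq_bigr do rewrite -sum1_card big_mkcond.
  rewrite exchange_big /= mulnC -sum_nat_const big_mkcond; apply: eq_bigr => X _.
  case: ifP => [XD|nXD].
    have -> : n.+1 - (P + r) = #|~: (X.1 :|: X.2)|.
      by have := cardsC (X.1 :|: X.2); rewrite size_pair // card_ord; lia.
    by rewrite -sum1_card big_mkcond; apply: eq_bigr => i _; rewrite inE [in RHS]inE XD.
  by rewrite big1 // => i _; rewrite inE nXD.
rewrite -[X in _ <= X * _](card_ord n.+1) -sum_nat_const; apply: leq_sum => i _.
apply: leq_trans (layer_pairs_delete _ _ _ _) _; apply: layer_pairs_le => //.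
  by move=> j; rewrite /D ltnn.
by move=> k j l; apply: ltn_trans.
Qed.

(** Every factor of the falling factorial is at least [n / 2]. *)
Lemma expn_le_bin (n m : nat) : 0 < m -> m.*2 <= n ->
  n.+1 * n ^ m.-1 <= 2 ^ m.+1 * m`! * 'C(n, m).
Proof.
move=> m_gt0 le_2mn.
apply: (@leq_trans (2 * n ^ m)).
  rewrite -[in leqRHS](prednK m_gt0) expnS mulnA leq_mul2r; apply/orP; right; lia.
rewrite expnS -!mulnA leq_mul2l /= [m`! * _]mulnC bin_ffact.
apply: (@leq_trans (2 ^ m * (n.+1 - m) ^ m)).
  by rewrite -expnMn leq_exp2r //; lia.
by rewrite leq_mul2l expn_le_ffact orbT.
Qed.

(** The functions [Q * best_split p q t] and [S * 'C(t, p + q)] lie between the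
same two polynomials, which differ by a shift of the argument by [p + q]. *)
Lemma max_pair_sum_split_close n (p q r : nat) : 0 < p -> 0 < q -> 0 < r ->
  let V := max_pair_sum n (best_split p q) (fun t => 'C(t, r)) in
  let W := max_pair_sum n (fun t => 'C(t, p + q)) (fun t => 'C(t, r)) in
  let Q := (p + q) ^ (p + q) * (p`! * q`!) in
  let S := p ^ p * q ^ q * (p + q)`! in
  let K := p ^ p * q ^ q * ((p + q) * (p + q)) in
  Q * V <= S * W + K * n ^ (p + q + r).-1 /\
  S * W <= Q * V + K * n ^ (p + q + r).-1.
Proof.
move=> p_gt0 q_gt0 r_gt0 V W Q S K.
have M_le t : p ^ p * q ^ q * t ^ (p + q) <=
    p ^ p * q ^ q * (t - (p + q)) ^ (p + q) + K * t ^ (p + q).-1.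
  have -> : K * t ^ (p + q).-1 =
      p ^ p * q ^ q * ((p + q) * (p + q) * t ^ (p + q).-1) by rewrite /K -!mulnA.
  by rewrite -mulnDr leq_mul2l expn_gap orbT.
have le_bin t : 'C(t, r) <= t ^ r.
  by apply: leq_trans (bin_le r t); rewrite leq_pmull ?fact_gt0.
have -> : (p + q + r).-1 = (p + q).-1 + r by lia.
rewrite /V /W -!max_pair_sum_scale; split; apply: max_pair_sum_close => //; try lia.
- move=> t; apply: leq_trans (best_split_le p_gt0 q_gt0 t) _.
  apply: leq_trans (M_le t) _; rewrite leq_add2r /S -[leqRHS]mulnA.
  by rewrite leq_mul2l bin_ge orbT.
- move=> t; apply: (@leq_trans (p ^ p * q ^ q * t ^ (p + q))).
    by rewrite /S -mulnA leq_mul2l bin_le orbT.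
  by apply: leq_trans (M_le t) _; rewrite leq_add2r best_split_ge.
Qed.

Local Open Scope classical_set_scope.
Local Open Scope ring_scope.

(** The averaged deletion inequality says that the quotients decrease from
[P + r] on; below [P + r] they vanish, hence the shift of the sequence. *)
Lemma cvg_two_layer_density (R : realType) (P r : nat) : (0 < P)%N -> (0 < r)%N ->
  cvgn (fun n => (max_pair_sum n (fun t => 'C(t, P)) (fun t => 'C(t, r)))%:R
                   / 'C(n, P + r)%:R : R).
Proof.
move=> P_gt0 r_gt0; set u := fun n => _; set m := (P + r)%N.
have cvg_shift : cvgn [sequence u (n + m)%N]_n.
  apply: nonincreasing_is_cvgn; last first.
    by exists 0 => _ [n _ <-]; rewrite divr_ge0 ?ler0n.
  apply/nonincreasing_seqP => n /=; rewrite /u addSn; set k := (n + m)%N.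
  have Ck : 0 < 'C(k, P + r)%:R :> R by rewrite ltr0n bin_gt0 leq_addl.
  have Ck1 : 0 < 'C(k.+1, P + r)%:R :> R.
    by rewrite ltr0n bin_gt0 leqW // leq_addl.
  rewrite ler_pdivrMr // mulrAC ler_pdivlMr //.
  rewrite -!natrM ler_nat -(leq_pmul2l (ltn0Sn k)).
  have := max_pair_sum_delete k P_gt0 r_gt0; have := mul_bin_down k.+1 m; rewrite -/m /=.
  set W := max_pair_sum k _ _; set W' := max_pair_sum k.+1 _ _ => e le_W.
  rewrite [(W' * _)%N]mulnC mulnA e mulnAC !mulnA leq_mul2r.
  by rewrite le_W orbT.
apply/cvg_ex; move/cvg_ex: cvg_shift => [l]; rewrite cvg_shiftn => ul.
by exists l.
Qed.

Lemma cvg_harmonic_perturb (R : realType) (u v : R^nat) (l E : R) :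
  (\forall n \near \oo, `|u n - v n| <= E * harmonic n) ->
  v @ \oo --> l -> u @ \oo --> l.
Proof.
move=> near_uv vl.
have E0 : (fun n => E * harmonic n) @ \oo --> 0.
  rewrite -[X in _ --> X](mulr0 E); apply: cvgM; [exact: cvg_cst|exact: cvg_harmonic].
apply: (@squeeze_cvgr _ _ _ _ (fun n => v n - E * harmonic n) (fun n => v n + E * harmonic n)).
- near=> n; have : `|u n - v n| <= E * harmonic n by near: n.
  by rewrite ler_distl.
- by rewrite -[l]subr0; apply: cvgB.
- by rewrite -[l]addr0; apply: cvgD.
Unshelve. all: by end_near.
Qed.

Theorem theorem2p9 (R : realType) (p q r : nat)
    (hp : (1 <= p)%N) (hq : (1 <= q)%N) (hr : (1 <= r)%N) :
  let c : R := 'C(p + q, p)%:R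
    * (p%:R ^+ p * q%:R ^+ q / (p + q)%:R ^+ (p + q)) in
  packing_density R (word121 p r q)
    = c * packing_density R (word12 (p + q) r) /\
  c * packing_density R (word12 (p + q) r)
    = c * packing_density R (layered2 (p + q) r).
Proof.
move=> c; have pq_gt0 : (0 < p + q)%N by rewrite addn_gt0 hp.
set m := (p + q + r)%N.
pose V n := max_pair_sum n (best_split p q) (fun t => 'C(t, r)).
pose W n := max_pair_sum n (fun t => 'C(t, p + q)) (fun t => 'C(t, r)).
have dV : (fun n => delta R (word121 p r q) n n) = fun n => (V n)%:R / 'C(n, m)%:R.
  apply/funext => n; rewrite /delta max_nu121 // !size_cat !size_nseq.
  by rewrite addnCA addnC.
have dW : (fun n => delta R (word12 (p + q) r) n n) = fun n => (W n)%:R / 'C(n, m)%:R.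
  by apply/funext => n; rewrite /delta max_nu12 // size_cat !size_nseq.
have dL : (fun n => delta R (layered2 (p + q) r) n n) = fun n => (W n)%:R / 'C(n, m)%:R.
  by apply/funext => n; rewrite /delta max_nu_layered2 // size_layered2.
rewrite /packing_density dV dW dL; split=> //.
have /cvg_ex[l Wl] := @cvg_two_layer_density R (p + q) r pq_gt0 hr.
rewrite (cvg_lim _ Wl) //; apply/cvg_lim => //.
pose Q := ((p + q) ^ (p + q) * (p`! * q`!))%N.
pose S := (p ^ p * q ^ q * (p + q)`!)%N.
pose K := (p ^ p * q ^ q * ((p + q) * (p + q)))%N.
have Q_gt0 : 0 < Q%:R :> R by rewrite ltr0n !muln_gt0 expn_gt0 pq_gt0 !fact_gt0.
have cE : c = S%:R / Q%:R.
  rewrite /c /S /Q -(bin_fact (leq_addr q p)) addKn !natrM !natrX.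
  field.
  by rewrite expf_neq0 !pnatr_eq0 -!lt0n ?fact_gt0.
apply: (@cvg_harmonic_perturb _ _ (fun n => c * ((W n)%:R / 'C(n, m)%:R)) _
  (K%:R * (2 ^ m.+1 * m`!)%:R / Q%:R)); last first.
  by apply: cvgM => //; apply: cvg_cst.
near=> n.
have le_2mn : (m.*2 <= n)%N by near: n; apply: nbhs_infty_ge.
have C_gt0 : 0 < 'C(n, m)%:R :> R by rewrite ltr0n bin_gt0; lia.
have [leV leW] := max_pair_sum_split_close n hp hq hr.
rewrite -/(V n) -/(W n) -/Q -/S -/K -/m in leV leW.
have err : (n ^ m.-1)%:R / 'C(n, m)%:R <= (2 ^ m.+1 * m`!)%:R * harmonic n :> R.
  rewrite ler_pdivrMr // mulrAC /= ler_pdivlMr ?ltr0n // -!natrM ler_nat mulnC.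
  by apply: expn_le_bin => //; rewrite /m; lia.
have dist : `|Q%:R * (V n)%:R - S%:R * (W n)%:R| <= K%:R * (n ^ m.-1)%:R :> R.
  by rewrite ler_distl lerBlDr -!natrM -!natrD !ler_nat leV leW.
rewrite cE.
have -> : (V n)%:R / 'C(n, m)%:R - S%:R / Q%:R * ((W n)%:R / 'C(n, m)%:R) =
    (Q%:R * (V n)%:R - S%:R * (W n)%:R) / (Q%:R * 'C(n, m)%:R) :> R.
  by field; rewrite !gt_eqF.
rewrite normrM normfV (gtr0_norm (mulr_gt0 Q_gt0 C_gt0)) ler_pdivrMr ?mulr_gt0 //.
apply: le_trans dist _.
have -> : K%:R * (2 ^ m.+1 * m`!)%:R / Q%:R * harmonic n * (Q%:R * 'C(n, m)%:R) =
   K%:R * ((2 ^ m.+1 * m`!)%:R * harmonic n * 'C(n, m)%:R) :> R.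
  by field; rewrite gt_eqF.
by rewrite ler_wpM2l ?ler0n // -ler_pdivrMr.
Unshelve. all: by end_near.
Qed.
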